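(* Let $n\ge 1$ and let $(\mathbb{C}^n,\omega_{RS})$ be a gradient Kähler--Ricci soliton of Cao's type, i.e. $\omega_{RS}=\frac{i}{2}\partial\bar\partial\Phi$ is the Kähler form on $\mathbb{C}^n$ with radial potential $\Phi(z,\bar z)=u(\log\|z\|^2)$, where $u:\mathbb{R}\to\mathbb{R}$ is a smooth function satisfying $$(u'(t))^{n-1}\,u''(t)\,e^{u'(t)}=e^{nt}\qquad\text{for all } t\in\mathbb{R},$$ and having, as $t\to-\infty$, an expansion $$u(t)=a_0+a_1e^{t}+a_2e^{2t}+\cdots,\qquad a_1=1.$$ Then $(\mathbb{C}^n,\omega_{RS})$ is globally symplectomorphic to $(\mathbb{R}^{2n},\omega_0)$, where $\omega_0=\sum_{j=1}^n dx_j\wedge dy_j$; that is, there exists a diffeomorphism $\Psi:\mathbb{C}^n\to\mathbb{R}^{2n}$ with $\Psi^*\omega_0=\omega_{RS}$.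
   Context: Notation: $\|z\|^2=|z_1|^2+\cdots+|z_n|^2$, and $t=\log\|z\|^2$ for $z\neq 0$. The space $\mathbb{R}^{2n}$ is identified with $\mathbb{C}^n$ via $z_j=x_j+iy_j$, so $\omega_0=\sum_j dx_j\wedge dy_j=\frac{i}{2}\sum_j dz_j\wedge d\bar z_j$. The expansion of $u$ as $t\to-\infty$ is a power-series type expansion in $e^t=\|z\|^2$ (valid also for derivatives), expressing that $\Phi$ extends to a smooth function on all of $\mathbb{C}^n$, and that $\omega_{RS}$ is a smooth Kähler form on all of $\mathbb{C}^n$, including at the origin. The following facts about such $u$ are recalled from H.-D. Cao's construction: $u'(t)>0$ and $u''(t)>0$ for all $t\in\mathbb{R}$, and $\lim_{t\to+\infty}u'(t)/t=n$, $\lim_{t\to+\infty}u''(t)=n$; the associated Kähler metric $g_{RS}$ is a complete, positively curved gradient Kähler--Ricci soliton. *)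

(* Defs.v *)
From HB Require Import structures.
From mathcomp Require Import all_boot all_order all_algebra.
From mathcomp Require Import complex.
From mathcomp Require Import all_classical all_reals all_analysis.

Set Implicit Arguments.
Unset Strict Implicit.
Unset Printing Implicit Defensive.
Import Order.TTheory GRing.Theory Num.Theory.
Import numFieldNormedType.Exports.
Local Open Scope classical_set_scope.
Local Open Scope ring_scope.
Local Open Scope complex_scope.

Section Smooth.
Context {R : realType}.

(* The directional derivatives of a C^{k+1} map are C^k maps; in finite
   dimension this is the usual definition by iterated partial derivatives. *)
Fixpoint Ck (V W : normedModType R) (k : nat) (f : V -> W) : Prop :=
  match k with
  | 0 => continuous f
  | k'.+1 => (forall x, differentiable f x) /\ (forall v, Ck k' ('D_v f))
  end.

Definition smooth (V W : normedModType R) (f : V -> W) : Prop :=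
  forall k, Ck k f.

Definition diffeomorphism (V W : normedModType R) (f : V -> W) : Prop :=
  smooth f /\ exists g : W -> V, [/\ smooth g, cancel f g & cancel g f].

End Smooth.

(* R^{2n} is the space of rows (x_1, ..., x_n, y_1, ..., y_n), and C^n is the
   same space through z_j = x_j + i y_j.  The functions x_j and y_j are linear,
   so they also serve as the constant 1-forms dx_j and dy_j, and likewise
   x_j + i y_j and x_j - i y_j as dz_j and d\bar z_j. *)
Notation R2n R n := 'rV[R]_(n + n).
Notation Cn R n := 'rV[R]_(n + n).

Section Forms.
Context {R : realType} {n : nat}.
Implicit Types (j : 'I_n) (z v w : Cn R n).

Definition dx j v : R := v 0 (lshift n j).
Definition dy j v : R := v 0 (rshift n j).
Definition dz j v : R[i] := dx j v +i* dy j v.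
Definition dzbar j v : R[i] := dx j v -i* dy j v.

Definition normsq z : R := \sum_j (dx j z ^+ 2 + dy j z ^+ 2).

(* A 2-form with values in A is given by its values on pairs of tangent
   vectors v, w at a point z; the convention is
   (alpha /\ beta)(v, w) = alpha v * beta w - alpha w * beta v. *)
Definition form2 (A : Type) := Cn R n -> Cn R n -> Cn R n -> A.

Definition wedge (A : pzRingType) (alpha beta : Cn R n -> A) v w : A :=
  alpha v * beta w - alpha w * beta v.

Definition omega0 : form2 R :=
  fun _ v w => \sum_j wedge (dx j) (dy j) v w.

Definition pullback (Psi : Cn R n -> R2n R n) (omega : form2 R) : form2 R :=
  fun z v w => omega (Psi z) ('d Psi z v) ('d Psi z w).

Definition Dcomplex v (f : Cn R n -> R[i]) z : R[i] :=
  'D_v (fun p => complex.Re (f p)) z +i* 'D_v (fun p => complex.Im (f p)) z.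

Definition partial_x j := Dcomplex (delta_mx 0 (lshift n j)).
Definition partial_y j := Dcomplex (delta_mx 0 (rshift n j)).

Definition partial_z j (f : Cn R n -> R[i]) z : R[i] :=
  (partial_x j f z - 'i%C * partial_y j f z) / 2.
Definition partial_zbar j (f : Cn R n -> R[i]) z : R[i] :=
  (partial_x j f z + 'i%C * partial_y j f z) / 2.

Definition ddbar (f : Cn R n -> R[i]) : form2 R[i] :=
  fun z v w => \sum_j \sum_k
    partial_z j (partial_zbar k f) z * wedge (dz j) (dzbar k) v w.

(* u (ln ||z||^2), extended to the origin by its limit a_0 there; the value of
   u at ln 0 is meaningless since ln 0 = 0 by convention. *)
Definition potential (u : R -> R) (a0 : R) : Cn R n -> R :=
  fun z => if z == 0 then a0 else u (ln (normsq z)).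

Definition omegaRS (u : R -> R) (a0 : R) : form2 R[i] :=
  fun z v w => 'i%C / 2 * ddbar (fun p => (potential u a0 p)%:C) z v w.

End Forms.

(* u(t) = a_0 + a_1 e^t + a_2 e^{2t} + ... as t -> -oo, as an asymptotic
   expansion which may be differentiated term by term any number of times. *)
Definition expansion_at_ninfty (R : realType) (u : R -> R) (a : nat -> R) :=
  forall N k : nat, exists C : R, \forall t \near -oo_R,
    `|derive1n k (fun s : R => u s - \sum_(j < N) a j * expR (j%:R * s)) t|
      <= C * expR (N%:R * t).

(* Main.v *)
Require Import Defs.
From mathcomp Require Import all_boot all_order all_algebra.
From mathcomp Require Import complex.
From mathcomp Require Import all_classical all_reals all_analysis.
From mathcomp Require Import ring lra.

(* Write s = ||z||^2 and Phi = f(s).  The map Psi(z) = sqrt(f'(s)) z pulls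
   omega0 back to (i/2) ddbar Phi, and ||Psi(z)||^2 = s f'(s) = u'(log s).
   The Cao equation integrates to n * int_0^x y^(n-1) e^y dy = s^n for
   x = u'(log s), i.e. to s = x (n Q(x))^(1/n), where
   Q(x) = int_0^1 r^(n-1) e^(r x) dr is entire and positive on the real line.
   Hence with L = ln (n Q) one has Psi(z) = exp (- L(x) / (2n)) z, with inverse
   w |-> exp (L(||w||^2) / (2n)) w; both are smooth across the origin, since x
   is a smooth function of z: D_v x = K(x) * 2 <z, v> with K smooth. *)

Set Implicit Arguments.
Unset Strict Implicit.
Unset Printing Implicit Defensive.
Import Order.TTheory GRing.Theory Num.Theory.
Import numFieldNormedType.Exports.
Local Open Scope classical_set_scope.
Local Open Scope ring_scope.
Local Open Scope complex_scope.

(** * Calculus of C^k maps *)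

Section CkMaps.
Context {R : realType}.
Implicit Types (V W : normedModType R) (k : nat).

Lemma Ck_continuous V W k (f : V -> W) : Ck k f -> continuous f.
Proof.
case: k => [//|k] [df _] x; exact/differentiable_continuous/df.
Qed.

Lemma CkW V W k (f : V -> W) : Ck k.+1 f -> Ck k f.
Proof.
elim: k f => [|k IHk] f; first exact: Ck_continuous.
by move=> [df ddf]; split=> // v; apply: IHk.
Qed.

Lemma Ck_cst V W k (c : W) : Ck k (fun _ : V => c).
Proof.
elim: k c => [|k IHk] c /=; first by move=> x; exact: cst_continuous.
split=> [x|v]; first exact: differentiable_cst.
rewrite (_ : 'D_v _ = fun=> 0)//; apply/funext => x; exact: derive_cst.
Qed.

Lemma CkD V W k (f g : V -> W) : Ck k f -> Ck k g -> Ck k (fun x => f x + g x).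
Proof.
elim: k f g => [|k IHk] f g /=; first by move=> cf cg x; apply: cvgD; [exact: cf|exact: cg].
move=> [df ddf] [dg ddg]; split=> [x|v]; first exact: differentiableD.
rewrite (_ : 'D_v _ = fun x => 'D_v f x + 'D_v g x); first exact: IHk.
by apply/funext => x; apply: deriveD; exact: diff_derivable.
Qed.

Lemma Ck_sum V W k n (f : 'I_n -> V -> W) :
  (forall i, Ck k (f i)) -> Ck k (fun x => \sum_i f i x).
Proof.
elim: n f => [|n IHn] f Cf.
  rewrite (_ : (fun _ => _) = fun=> 0); first exact: Ck_cst.
  by apply/funext => x; rewrite big_ord0.
rewrite (_ : (fun _ => _) = fun x => (\sum_(i < n) f (widen_ord (leqnSn n) i) x) + f ord_max x).
  by apply: CkD => //; apply: IHn.
by apply/funext => x; rewrite big_ord_recr.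
Qed.

Lemma Ck_linear V W k (f : {linear V -> W}) : continuous f -> Ck k f.
Proof.
case: k => [//|k] cf; split=> [x|v]; first exact: linear_differentiable.
rewrite (_ : 'D_v f = fun=> f v); first exact: Ck_cst.
by apply/funext => x; rewrite deriveE ?diff_lin//; exact: linear_differentiable.
Qed.

Lemma CkZl V W k (h : V -> R) (w : W) : Ck k h -> Ck k (fun x => h x *: w).
Proof.
elim: k h => [|k IHk] h /=; first by move=> ch x; apply: cvgZr_tmp; exact: ch.
move=> [dh ddh]; split=> [x|v]; first exact: differentiableZl.
rewrite (_ : 'D_v _ = fun x => 'D_v h x *: w); first exact: IHk.
apply/funext => x; rewrite !deriveE//; last exact: differentiableZl.
by rewrite diffZl.
Qed.

Lemma CkM V k (f g : V -> R) : Ck k f -> Ck k g -> Ck k (fun x => f x * g x).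
Proof.
elim: k f g => [|k IHk] f g.
  by move=> cf cg x; apply: cvgM; [exact: cf|exact: cg].
move=> Cf Cg; have [df ddf] := Cf; have [dg ddg] := Cg.
split=> [x|v]; first exact: differentiableM.
rewrite (_ : 'D_v _ = fun x => f x * 'D_v g x + g x * 'D_v f x).
  by apply: CkD; apply: IHk; [exact: (CkW Cf)|exact: ddg|exact: (CkW Cg)|exact: ddf].
by apply/funext => x; apply: deriveM; exact: diff_derivable.
Qed.

(** The hypothesis on [f] is pointwise because the outer functions [ln] and [moment] are controlled
    only on part of the line. *)
Lemma chain_rule_real V (f : R -> R) (g : V -> R) x v df dg :
  is_derive (g x) 1 f df -> differentiable g x -> 'D_v g x = dg ->
  differentiable (f \o g) x /\ 'D_v (f \o g) x = df * dg.
Proof.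
move=> [/derivable1_diffP dff dfE] dgx <-.
have dfg : differentiable (f \o g) x by exact: differentiable_comp.
split=> //; rewrite deriveE// diff_comp//= deriveE//.
by rewrite -[X in 'd f _ X]mulr1 [LHS]linearZ/= -[in RHS]dfE deriveE// mulrC.
Qed.

Lemma Ck_comp V k (f : R -> R) (g : V -> R) :
  Ck k f -> Ck k g -> Ck k (fun x => f (g x)).
Proof.
elim: k f g => [|k IHk] f g.
  by move=> cf cg x; apply: continuous_comp; [exact: cg|exact: cf].
move=> Cf Cg; have [df ddf] := Cf; have [dg ddg] := Cg.
have fg x v : differentiable (f \o g) x /\ 'D_v (f \o g) x = 'D_1 f (g x) * 'D_v g x.
  by apply: chain_rule_real; [exact/derivableP/diff_derivable|exact: dg|].
split=> [x|v]; first by case: (fg x 0).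
rewrite (_ : 'D_v _ = fun x => 'D_1 f (g x) * 'D_v g x).
  apply: CkM; last exact: ddg.
  by apply: (IHk ('D_1 f) g); [exact: ddf|exact: CkW].
by apply/funext => x; case: (fg x v).
Qed.

(* Bootstrap: the regularity of f is fed back into its own differential equation. *)
Lemma Ck_autonomous V k (f : V -> R) (F : R -> R) (l : V -> V -> R) :
  (forall k, Ck k F) -> (forall v k, Ck k (l v)) ->
  (forall x, differentiable f x) ->
  (forall v x, 'D_v f x = F (f x) * l v x) -> Ck k f.
Proof.
move=> CF Cl df ddf; elim: k => [|k IHk].
  by move=> x; exact/differentiable_continuous/df.
split=> // v; rewrite (_ : 'D_v f = fun x => F (f x) * l v x).
  by apply: CkM => //; exact: Ck_comp.
exact/funext.
Qed.

Lemma derive_real (f : R -> R) (x v df : R) :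
  is_derive x 1 f df -> 'D_v f x = df * v.
Proof.
move=> [/derivable1_diffP dff dfE]; rewrite deriveE//.
by rewrite -[X in 'd f _ X]mulr1 [LHS]linearZ/= -dfE deriveE// mulrC.
Qed.

(** On the line every direction is a multiple of 1, so a single derivative controls all directional
    ones. *)
Lemma CkS_real k (f df : R -> R) :
  (forall x : R, is_derive x 1 f (df x)) -> Ck k df -> Ck k.+1 f.
Proof.
move=> fdf Cdf; split=> [x|v]; first by apply/derivable1_diffP; case: (fdf x).
rewrite (_ : 'D_v f = fun x => df x * v); last exact/funext/(fun x => derive_real _ (fdf x)).
by apply: CkM => //; exact: Ck_cst.
Qed.

Lemma Ck_id k : Ck k (id : R -> R).
Proof. by apply: (@Ck_linear _ _ k idfun) => x; exact: cvg_id. Qed.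

Lemma Ck_expR k : Ck k (@expR R).
Proof.
elim: k => [|k IHk]; first exact: continuous_expR.
exact: (CkS_real (df := expR)).
Qed.

End CkMaps.

(** * The function Q *)

Section Kummer.
Context {R : realType}.
Implicit Types (m k : nat) (x : R).

Lemma MVT_lt (f df : R -> R) (a b : R) :
  (forall x : R, is_derive x 1 f (df x)) -> a < b ->
  exists2 c, a < c < b & f b - f a = df c * (b - a).
Proof.
move=> fdf ab; have [|c] := @MVT R f df a b ab (fun x _ => fdf x).
  apply: continuous_subspaceT => x; apply/differentiable_continuous/derivable1_diffP.
  by case: (fdf x).
by rewrite in_itv/= => cab E; exists c.
Qed.

(* kummer m x = int_0^1 r^(m-1) exp (r x) dr, expanded as a power series; up to
   the factor m it is Kummer's function M(m, m + 1, x). *)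
Definition kummer_coeff m k : R := (k`!%:R * (m + k)%:R)^-1.

Definition kummer m x : R := limn (pseries (kummer_coeff m) x).

(** Since m + k >= 1, the terms are dominated by those of the exponential series at |x|. *)
Lemma cvg_kummer m x : (0 < m)%N -> cvgn (pseries (kummer_coeff m) x).
Proof.
move=> m0; apply: normed_cvg; rewrite /normed_series_of/=.
apply: (series_le_cvg _ _ _ (is_cvg_series_exp_coeff `|x|)) => k //.
  exact: exp_coeff_ge0.
rewrite /exp_coeff/= normrM normrX mulrC ler_wpM2l ?exprn_ge0//.
rewrite /kummer_coeff invfM normrM !normfV !normr_nat ler_piMr ?invr_ge0//.
by rewrite invf_le1 ?ltr0n ?ler1n ?addn_gt0 ?m0.
Qed.

(** Differentiating under the integral sign brings down a factor r, which raises m by one; on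
    coefficients, k + 1 cancels against (k+1)!. *)
Lemma pseries_diffs_kummer m : pseries_diffs (kummer_coeff m) = kummer_coeff m.+1.
Proof.
apply/funext => k; rewrite /pseries_diffs /kummer_coeff factS natrM addnS addSn.
by rewrite !invfM !mulrA divff// mul1r.
Qed.

Lemma is_derive_kummer m x : (0 < m)%N -> is_derive x 1 (kummer m) (kummer m.+1 x).
Proof.
move=> m0; rewrite /kummer -pseries_diffs_kummer.
apply: (@pseries_snd_diffs _ _ (`|x| + 1)); rewrite ?pseries_diffs_kummer; try exact: cvg_kummer.
by rewrite [ltRHS]ger0_norm ?addr_ge0// ltrDl.
Qed.

(** This is the integral of d(r^m exp(r x)) over [0, 1]. Without integrals, it is the coefficient
    identity m/((k+1)! (m+k+1)) + 1/(k! (m+k+1)) = 1/(k+1)!. *)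
Lemma kummer_recurrence m x : (0 < m)%N ->
  m%:R * kummer m x + x * kummer m.+1 x = expR x.
Proof.
move=> m0; set a := kummer_coeff m; set b := kummer_coeff m.+1.
(* The factor x shifts the second series by one degree, so the other two partial sums take one more
   term. *)
have ca : [sequence pseries a x n.+1]_n @ \oo --> kummer m x.
  by rewrite cvg_shiftS; exact: cvg_kummer.
have cb : pseries b x @ \oo --> kummer m.+1 x by exact: cvg_kummer.
have ce : [sequence series (exp_coeff x) n.+1]_n @ \oo --> expR x.
  by rewrite cvg_shiftS; exact: is_cvg_series_exp_coeff.
have cab : (fun N => m%:R * pseries a x N.+1 + x * pseries b x N) @ \oo -->
    m%:R * kummer m x + x * kummer m.+1 x.
  by apply: cvgD; [exact: cvgMl_tmp ca|exact: cvgMl_tmp cb].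
rewrite -(cvg_lim (@norm_hausdorff _ _) cab) -(cvg_lim (@norm_hausdorff _ _) ce).
congr (limn _).
apply/funext => N; rewrite /pseries /series/=.
rewrite [in RHS]big_nat_recl//. rewrite mulr_sumr big_nat_recl//=.
rewrite /exp_coeff/= expr0 fact0 divr1 -addrA; congr (_ + _).
  by rewrite /a /kummer_coeff addn0 fact0 mul1r mulr1 divff// pnatr_eq0 -lt0n.
rewrite mulr_sumr -big_split/=; apply: eq_bigr => i _.
have i1 : i.+1%:R != 0 :> R by rewrite pnatr_eq0.
have mi : m%:R + i.+1%:R != 0 :> R by rewrite -natrD pnatr_eq0 addnS.
have fi : i`!%:R != 0 :> R by rewrite pnatr_eq0 -lt0n fact_gt0.
rewrite /a /b /kummer_coeff addSnnS factS !natrM !natrD exprS.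
move: (i.+1%:R : R) (i`!%:R : R) i1 fi mi => p q p0 q0 mp0.
by field; rewrite p0 q0 mp0.
Qed.

(** The function is int_0^x y^(m-1) exp y dy; the product rule leaves x^(m-1) times the left side of
    [kummer_recurrence]. *)
Lemma is_derive_expn_kummer m x : (0 < m)%N ->
  is_derive x 1 (fun y => y ^+ m * kummer m y) (x ^+ m.-1 * expR x).
Proof.
move=> m0; have dQ := is_derive_kummer x m0.
have dX := is_deriveX m (is_derive_id x (1 : R)).
rewrite (_ : (fun _ => _) = id ^+ m * kummer m); last by apply/funext => y; rewrite !fctE.
apply: is_derive_eq.
rewrite -(kummer_recurrence x m0).
case: m m0 dQ dX => // m _ _ _. rewrite -pred_Sn exprfctE /GRing.scale/=.
rewrite exprS; move: (kummer m.+1 x) (kummer m.+2 x) (m.+1%:R : R) (x ^+ m) => p q c y.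
by ring.
Qed.

(** For x < 0 the series alternates in sign, so positivity is read off from [kummer m x] =
    (c/x)^(m-1) exp c with c between 0 and x. *)
Lemma kummer_gt0 m x : (0 < m)%N -> 0 < kummer m x.
Proof.
move=> m0.
have D (y : R) : is_derive y 1 (fun y => y ^+ m * kummer m y) (y ^+ m.-1 * expR y).
  exact: is_derive_expn_kummer.
(* The mean value theorem for y^m * kummer m y between 0 and x. *)
have key c : x != 0 -> 0 < c / x -> x ^+ m * kummer m x = c ^+ m.-1 * expR c * x ->
    0 < kummer m x.
  move=> x0 cx E; suff -> : kummer m x = (c / x) ^+ m.-1 * expR c.
    by rewrite mulr_gt0 ?exprn_gt0 ?expR_gt0.
  apply: (mulfI (expf_neq0 m x0)); rewrite E expr_div_n -[in X in _ = X * _](prednK m0) exprS.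
  by field; rewrite expf_neq0.
have [x0|x0|->] := ltgtP x 0.
- have [c /andP[xc c0]] := MVT_lt D x0.
  rewrite expr0n gtn_eqF// mul0r => E; apply: (key c); first by rewrite lt_eqF.
    by rewrite -divrNN divr_gt0 ?oppr_gt0.
  by rewrite -[LHS]opprK -[- (x ^+ m * _)]add0r E; ring.
- have [c /andP[xc c0]] := MVT_lt D x0.
  rewrite expr0n gtn_eqF// mul0r !subr0 => E; apply: (key c) => //; first by rewrite gt_eqF.
  by rewrite divr_gt0.
- have := kummer_recurrence 0 m0; rewrite mul0r addr0 expR0 => E.
  by rewrite -(@pmulr_rgt0 _ m%:R) ?ltr0n// E.
Qed.

Lemma Ck_kummer k m : (0 < m)%N -> Ck k (kummer m).
Proof.
elim: k m => [|k IHk] m m0.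
  move=> x; apply/differentiable_continuous/derivable1_diffP.
  by case: (is_derive_kummer x m0).
apply: (CkS_real (df := kummer m.+1)) => [x|].
  exact: is_derive_kummer.
by apply: IHk.
Qed.

(** The factor m normalises the argument of [ln] to 1 at x = 0. *)
Definition lnkummer m x : R := ln (m%:R * kummer m x).

Lemma expR_lnkummer m x : (0 < m)%N -> expR (lnkummer m x) = m%:R * kummer m x.
Proof. by move=> m0; rewrite lnK// posrE mulr_gt0 ?ltr0n// kummer_gt0. Qed.

(** The reciprocal is written as exp(-L), so that [Ck_lnkummer] can feed the regularity of L back
    into its own derivative. *)
Lemma is_derive_lnkummer m x : (0 < m)%N ->
  is_derive x 1 (lnkummer m) (m%:R * kummer m.+1 x * expR (- lnkummer m x)).
Proof.
move=> m0; have mQ : 0 < m%:R * kummer m x by rewrite mulr_gt0 ?ltr0n// kummer_gt0.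
have dln := is_derive1_ln mQ; have dQ := is_derive_kummer x m0.
have dg := is_deriveZ m%:R dQ.
have := @is_derive1_comp R (@ln R) (m%:R \*: kummer m) x _ _ dln dg.
by rewrite expRN expR_lnkummer// mulrC.
Qed.

Lemma Ck_lnkummer k m : (0 < m)%N -> Ck k (lnkummer m).
Proof.
move=> m0; elim: k => [|k IHk].
  move=> x; apply/differentiable_continuous/derivable1_diffP.
  by case: (is_derive_lnkummer x m0).
apply: (@CkS_real R k (lnkummer m) _ (fun x => is_derive_lnkummer x m0)).
apply: CkM. apply: CkM. exact: Ck_cst. exact: Ck_kummer.
apply: (Ck_comp (f := expR)). exact: Ck_expR.
rewrite (_ : (fun _ => _) = fun x => (-1) * lnkummer m x).
  by apply: CkM => //; exact: Ck_cst.
by apply/funext => x; rewrite mulN1r.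
Qed.

End Kummer.

(** * The change of variable s = x (n Q(x))^(1/n) *)

Section Radial.
Context {R : realType}.
Implicit Types (m k : nat) (x s : R).

Definition radial m x : R := x * expR (lnkummer m x / m%:R).

(** Differentiating s^m = m int_0^x y^(m-1) exp y dy gives s' = (x/s)^(m-1) exp x; here x is
    cancelled from x/s, leaving one exponential, regular at 0 and visibly positive. *)
Definition radial_slope m x : R := expR (lnkummer m x / m%:R - lnkummer m x + x).

Lemma is_derive_radial m x : (0 < m)%N -> is_derive x 1 (radial m) (radial_slope m x).
Proof.
move=> m0; have m0' : m%:R != 0 :> R by rewrite pnatr_eq0 -lt0n.
have dL := is_deriveZ (m%:R^-1) (is_derive_lnkummer x m0).
have dE := @is_derive1_comp R expR (m%:R^-1 \*: lnkummer m) x _ _ (is_derive_expR _) dL.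
have d := is_deriveM (is_derive_id x (1 : R)) dE.
rewrite (_ : radial m = id * (expR \o (m%:R^-1 \*: lnkummer m))); last first.
  by apply/funext => y; rewrite /radial fctE/= /GRing.scale/= [_ / _]mulrC.
apply: (is_derive_eq d); rewrite /radial_slope /= /GRing.scale/=.
(* The product rule gives exp(L/m) (1 + x Q' exp(-L)), and the recurrence reads exp x = exp L + x
   Q'. *)
rewrite [m%:R^-1 * lnkummer m x]mulrC !expRD -(kummer_recurrence x m0).
rewrite mulrDr -(expR_lnkummer x m0).
have eLN : expR (lnkummer m x) * expR (- lnkummer m x) = 1 by exact: expRxMexpNx_1.
move: eLN; move: (expR (lnkummer m x)) (expR (- lnkummer m x)).
move: (expR (lnkummer m x / _)) (kummer _ x) => r t p q pq.
rewrite -[r * q * p]mulrA [q * p]mulrC pq.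
by field.
Qed.

Lemma radial_slope_gt0 m x : 0 < radial_slope m x. Proof. exact: expR_gt0. Qed.

Lemma radial_lt m : (0 < m)%N -> {homo radial m : x y / x < y}.
Proof.
move=> m0 x y xy; have [c _ E] := MVT_lt (fun x => is_derive_radial x m0) xy.
by rewrite -subr_gt0 E mulr_gt0 ?subr_gt0// radial_slope_gt0.
Qed.

Lemma radial_inj m : (0 < m)%N -> injective (radial m).
Proof.
by move=> m0 x y E; have [/(radial_lt m0)|/(radial_lt m0)|//] := ltgtP x y; rewrite E ltxx.
Qed.

Lemma radial0 m : radial m 0 = 0. Proof. by rewrite /radial mul0r. Qed.

Lemma radial_exp m x : (0 < m)%N -> radial m x ^+ m = m%:R * (x ^+ m * kummer m x).
Proof.
move=> m0; rewrite /radial exprMn -expRM_natl [_ * (_ / _)]mulrC divfK.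
  by rewrite expR_lnkummer// mulrCA.
by rewrite pnatr_eq0 -lt0n.
Qed.

(** For x >= 0, L >= 0 because [kummer m] increases from 1/m. This bounds the interval on which
    [radial_surj] applies the intermediate value theorem. *)
Lemma radial_ge m x : (0 < m)%N -> 0 <= x -> x <= radial m x.
Proof.
move=> m0 x0; rewrite /radial ler_peMr// -expR0 ler_expR divr_ge0//.
rewrite /lnkummer ln_ge0//.
have := kummer_recurrence (0 : R) m0; rewrite mul0r addr0 expR0 => {1}<-.
rewrite ler_wpM2l//.
move: x0; rewrite le_eqVlt => /predU1P[<-//|x0].
have [c _ E] := MVT_lt (fun y => is_derive_kummer y m0) x0.
by rewrite -subr_ge0 E subr0 mulr_ge0 ?ltW// kummer_gt0.
Qed.

Lemma continuous_radial m : (0 < m)%N -> continuous (radial m).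
Proof.
move=> m0 x; apply/differentiable_continuous/derivable1_diffP.
by case: (is_derive_radial x m0).
Qed.

Lemma radial_surj m s : (0 < m)%N -> 0 <= s -> exists2 x, 0 <= x & radial m x = s.
Proof.
move=> m0 s0; have rs := radial_ge m0 s0.
have [||c] := @IVT R (radial m) 0 s s s0.
- exact/continuous_subspaceT/continuous_radial.
- by rewrite radial0 ge_min s0 le_max rs orbT.
- by rewrite in_itv/= => /andP[c0 _] E; exists c.
Qed.

(* A left inverse of [radial m]; the value is meaningful only on its range, which
   is an open interval containing all s >= 0. *)
Definition moment m s : R := xget 0 [set x | radial m x = s].

Lemma radialK m : (0 < m)%N -> cancel (radial m) (moment m).
Proof.
move=> m0 x; rewrite /moment; by case: xgetP => [y _ /(radial_inj m0)//|/(_ x)/(_ erefl)].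
Qed.

Lemma momentK m s : (0 < m)%N -> 0 <= s -> radial m (moment m s) = s.
Proof. by move=> m0 /(radial_surj m0)[x _ <-]; rewrite radialK. Qed.

(** The derivative is two-sided even at s = 0, because [radial m] is strictly increasing on the
    whole line and also takes values below 0. Smoothness across the origin rests on this. *)
Lemma is_derive_moment m s : (0 < m)%N -> 0 <= s ->
  is_derive s 1 (moment m) (radial_slope m (moment m s))^-1.
Proof.
move=> m0 s0; rewrite -{1}(momentK m0 s0).
apply: is_derive_inverse.
- by near=> x; exact: radialK.
- by near=> x; exact: continuous_radial.
- exact: is_derive_radial.
- by rewrite gt_eqF// radial_slope_gt0.
Unshelve. all: by end_near. Qed.

End Radial.

(** * Coordinate functions, the Euclidean inner product and the squared norm *)

Section Coordinates.
Context {R : realType}.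

Lemma derive_coord m n (i : 'I_m) (j : 'I_n) (v z : 'M[R]_(m, n)) :
  'D_v (fun y : 'M[R]_(m, n) => y i j) z = v i j.
Proof.
have := @derive_mx _ _ _ _ (id : 'M[R]_(m, n) -> _) z v (@derivable_id _ _ z v).
by rewrite derive_id => {2}->; rewrite mxE.
Qed.

Lemma Ck_coord k m n (i : 'I_m) (j : 'I_n) : Ck k (fun y : 'M[R]_(m, n) => y i j).
Proof.
case: k => [|k]; first by move=> z; exact/differentiable_continuous/differentiable_coord.
split=> [z|v]; first exact: differentiable_coord.
rewrite (_ : 'D_v _ = fun=> v i j); first exact: Ck_cst.
by apply/funext => z; rewrite derive_coord.
Qed.

Variable n : nat.
Implicit Types z v w : Cn R n.

Definition inner z v : R := \sum_j (dx j z * dx j v + dy j z * dy j v).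

Lemma normsq_ge0 z : 0 <= normsq z.
Proof. by apply: sumr_ge0 => j _; rewrite addr_ge0 ?sqr_ge0. Qed.

Lemma normsq_eq0 z : (normsq z == 0) = (z == 0).
Proof.
apply/idP/eqP => [|->]; last first.
  by rewrite /normsq big1// => j _; rewrite /dx /dy !mxE expr0n addr0.
rewrite psumr_eq0 => [/allP H|j _]; last by rewrite addr_ge0 ?sqr_ge0.
apply/rowP => i; rewrite mxE -(splitK i); case: (fintype.split i) => j /=.
all: have /= := H j (mem_index_enum j); rewrite paddr_eq0 ?sqr_ge0// !sqrf_eq0.
all: by move=> /andP[/eqP dx0 /eqP dy0].
Qed.

Lemma Ck_inner k v : Ck k (fun z => inner z v).
Proof.
by apply: Ck_sum => j; apply: CkD; apply: CkM; try exact: Ck_coord; exact: Ck_cst.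
Qed.

Lemma Ck_normsq k : Ck k (@normsq R n).
Proof.
by apply: Ck_sum => j; apply: CkD; apply: CkM; exact: Ck_coord.
Qed.

Lemma differentiable_normsq z : differentiable (@normsq R n) z.
Proof. by case: (Ck_normsq 1). Qed.

Lemma derive_normsq v z : 'D_v (@normsq R n) z = 2 * inner z v.
Proof.
have dc i : is_derive z v (fun y : Cn R n => y 0 i) (v 0 i).
  by split; [exact/diff_derivable/differentiable_coord|exact: derive_coord].
pose h (j : 'I_n) : Cn R n -> R := dx j * dx j + dy j * dy j.
have dh j : is_derive z v (h j) (2 * (dx j z * dx j v + dy j z * dy j v)).
  have dX := dc (lshift n j); have dY := dc (rshift n j).
  apply: (is_derive_eq (is_deriveD (is_deriveM dX dX) (is_deriveM dY dY))).
  rewrite /GRing.scale/= /dx /dy.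
  by move: (z 0 _) (z 0 _) (v 0 _) (v 0 _) => p q r s; ring.
rewrite (_ : @normsq R n = \sum_j h j); last first.
  by apply/funext => y; rewrite fct_sumE.
have [_ ->] := is_derive_sum dh.
by rewrite mulr_sumr.
Qed.

End Coordinates.

(** * The symplectomorphism, its inverse, and the pullback of the standard form *)

Section CaoSymplectomorphism.
Context {R : realType} (n : nat).
Hypothesis n_gt0 : (0 < n)%N.
Implicit Types (z v w : Cn R n) (c : R).

Lemma normsqZ c z : normsq (c *: z) = c ^+ 2 * normsq z.
Proof.
rewrite /normsq mulr_sumr; apply: eq_bigr => j _.
by rewrite /dx /dy !mxE; ring.
Qed.

(** Away from the origin this is u'(log ||z||^2) by [profile1E], but it is defined without u and
    takes the value 0 at the origin. *)
Definition moment_of z : R := moment n (normsq z).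

Lemma radial_moment_of z : radial n (moment_of z) = normsq z.
Proof. by apply: momentK => //; exact: normsq_ge0. Qed.

Lemma derive_moment_of z v :
  differentiable moment_of z /\
  'D_v moment_of z = (radial_slope n (moment_of z))^-1 * (2 * inner z v).
Proof.
apply: chain_rule_real; last exact: derive_normsq.
  by apply: is_derive_moment => //; exact: normsq_ge0.
exact: differentiable_normsq.
Qed.

Lemma Ck_moment_of k : Ck k moment_of.
Proof.
(* exp L is the reciprocal of [radial_slope], so [derive_moment_of] is an autonomous equation with
   smooth coefficients. *)
pose L x : R := lnkummer n x + - n%:R^-1 * lnkummer n x + -1 * x.
apply: (@Ck_autonomous R _ k moment_of (fun x => expR (L x)) (fun v z => 2 * inner z v)).
- move=> j; apply: Ck_comp; first exact: Ck_expR.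
  apply: CkD; last by apply: CkM; [exact: Ck_cst|exact: Ck_id].
  by apply: CkD; [|apply: CkM; [exact: Ck_cst|]]; exact: Ck_lnkummer.
- by move=> v j; apply: CkM; [exact: Ck_cst|exact: Ck_inner].
- by move=> z; case: (derive_moment_of z 0).
- move=> v z; have [_ ->] := derive_moment_of z v.
  by rewrite /radial_slope -expRN /L; congr (expR _ * _); ring.
Qed.

(** The exponent c is free so that one family contains both the scaling of [cao_map] (c = -1/(2n))
    and its square [metric_factor] (c = -1/n). *)
Definition conformal c z : R := expR (c * lnkummer n (moment_of z)).

Lemma Ck_conformal k c : Ck k (conformal c).
Proof.
apply: (Ck_comp (f := expR)); first exact: Ck_expR.
apply: CkM; first exact: Ck_cst.
by apply: (Ck_comp (f := lnkummer n)); [exact: Ck_lnkummer|exact: Ck_moment_of].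
Qed.

Lemma differentiable_conformal c z : differentiable (conformal c) z.
Proof. by case: (Ck_conformal 1 c). Qed.

(** The coefficient of <z, v> in the derivative of L(x) along v, with x = [moment_of z]. *)
Definition conformal_slope z : R :=
  2 * (n%:R * kummer n.+1 (moment_of z) * expR (- lnkummer n (moment_of z))
       / radial_slope n (moment_of z)).

Lemma derive_conformal c z v :
  'D_v (conformal c) z = c * conformal c z * conformal_slope z * inner z v.
Proof.
have [dX DX] := derive_moment_of z v.
have dL := is_deriveZ c (is_derive_lnkummer (moment_of z) n_gt0).
have dE := @is_derive1_comp R expR (c \*: lnkummer n) _ _ _ (is_derive_expR _) dL.
have [_] := chain_rule_real dE dX DX.
rewrite /conformal /conformal_slope /comp/= /GRing.scale/= => ->.
move: (expR (c * _)) (expR (- _)) (kummer _ _) (radial_slope _ _)^-1 (inner z v) (n%:R : R).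
by move=> p q r s t y; ring.
Qed.

Lemma conformal_sqr c z : conformal c z ^+ 2 = conformal (c *+ 2) z.
Proof. by rewrite /conformal -expRM_natl mulrA mulr_natl. Qed.

Lemma Ck_rescale k (h : Cn R n -> R) : Ck k h -> Ck k (fun z => h z *: z).
Proof.
move=> Ch; rewrite (_ : (fun _ => _) = fun z => \sum_j (h z * z 0 j) *: delta_mx 0 j).
  by apply: Ck_sum => j; apply: CkZl; apply: CkM => //; exact: Ck_coord.
apply/funext => z; rewrite [X in _ *: X]row_sum_delta scaler_sumr.
by apply: eq_bigr => j _; rewrite scalerA.
Qed.

Lemma diff_rescale (h : Cn R n -> R) z v : Ck 1 h ->
  'd (fun y => h y *: y) z v = h z *: v + 'D_v h z *: z.
Proof.
move=> Ch; have [dh _] := Ch; have [dhz _] := Ck_rescale Ch.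
rewrite -deriveE// derive_mx; last exact: diff_derivable.
apply/matrixP => i j; rewrite !mxE.
have dc : derivable (fun y : Cn R n => y i j) z v by exact/diff_derivable/differentiable_coord.
rewrite (_ : (fun _ => _) = h * (fun y : Cn R n => y i j)); last by apply/funext => y; rewrite !mxE.
rewrite deriveM ?derive_coord//; last exact/diff_derivable/dh.
by rewrite /GRing.scale/= [z i j * _]mulrC.
Qed.

(** The form is constant, so the base point is free; the a b term vanishes because [omega0] is
    alternating. *)
Lemma omega0_rescale p z v w (h a b : R) :
  omega0 p (h *: v + a *: z) (h *: w + b *: z) =
  h ^+ 2 * omega0 z v w + (h * a * omega0 z z w - h * b * omega0 z z v).
Proof.
rewrite /omega0 /wedge -[- (_ * _)]mulNr !mulr_sumr -!big_split/=; apply: eq_bigr => j _.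
by rewrite /dx /dy !mxE; ring.
Qed.

Definition cao_map z : R2n R n := conformal (- (2 * n%:R)^-1) z *: z.

Definition cao_inv w : Cn R n := expR ((2 * n%:R)^-1 * lnkummer n (normsq w)) *: w.

Let double_half : (2 * n%:R)^-1 *+ 2 = n%:R^-1 :> R.
Proof. by rewrite -[LHS]mulr_natl invfM mulrA divff ?mul1r// pnatr_eq0. Qed.

(** The squared scaling factor exp(-L/n) cancels the exponential in s = x exp(L/n). *)
Lemma normsq_cao_map z : normsq (cao_map z) = moment_of z.
Proof.
rewrite normsqZ conformal_sqr mulNrn double_half -radial_moment_of /radial /conformal.
by rewrite mulNr [_^-1 * _]mulrC mulrCA [expR (- _) * _]mulrC expRxMexpNx_1 mulr1.
Qed.

Lemma moment_of_cao_inv w : moment_of (cao_inv w) = normsq w.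
Proof.
rewrite /moment_of normsqZ -expRM_natl mulrA [_%:R * _^-1]mulr_natl double_half.
by rewrite [_^-1 * _]mulrC [expR _ * _]mulrC -/(radial n _) radialK.
Qed.

Lemma cao_mapK : cancel cao_map cao_inv.
Proof.
move=> z; rewrite /cao_inv normsq_cao_map scalerA /conformal -expRD.
by rewrite mulNr addrN expR0 scale1r.
Qed.

Lemma cao_invK : cancel cao_inv cao_map.
Proof.
move=> w; rewrite /cao_map /conformal moment_of_cao_inv scalerA -expRD.
by rewrite mulNr addNr expR0 scale1r.
Qed.

Lemma diffeomorphism_cao_map : diffeomorphism cao_map.
Proof.
split=> [k|]; first exact/Ck_rescale/Ck_conformal.
exists cao_inv; split; [move=> k|exact: cao_mapK|exact: cao_invK].
apply: Ck_rescale; apply: (Ck_comp (f := expR)); first exact: Ck_expR.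
apply: CkM; first exact: Ck_cst.
by apply: (Ck_comp (f := lnkummer n)); [exact: Ck_lnkummer|exact: Ck_normsq].
Qed.

(** This is f'(s) = x/s where Phi = f(s), in a form that is also valid at the origin. *)
Definition metric_factor z : R := conformal (- n%:R^-1) z.

(** This is f''(s): the derivative of s along v is 2 <z, v>. *)
Definition metric_slope z : R := - (2 * n%:R)^-1 * metric_factor z * conformal_slope z.

Lemma derive_metric_factor z v :
  'D_v metric_factor z = 2 * metric_slope z * inner z v.
Proof.
rewrite derive_conformal /metric_slope /metric_factor -double_half.
move: (2 * n%:R)^-1 (conformal _ z) (conformal_slope z) (inner z v) => p q r s.
by ring.
Qed.

(** With h the scaling factor, h^2 is [metric_factor] and h D_v h is [metric_slope] times <z, v>.
    The right side is arranged to match [omega_radial]. *)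
Lemma pullback_cao_map z v w :
  pullback cao_map omega0 z v w =
  metric_factor z * omega0 z v w +
  metric_slope z * (inner z v * omega0 z z w - inner z w * omega0 z z v).
Proof.
rewrite /pullback !(diff_rescale _ _ (Ck_conformal 1 _)) omega0_rescale !derive_conformal.
rewrite /metric_slope /metric_factor -double_half -mulNrn -conformal_sqr.
move: (2 * n%:R)^-1 => b; move: (conformal _ z) (conformal_slope z) => h s.
move: (inner z v) (inner z w) (omega0 z v w) (omega0 z z v) (omega0 z z w) => *.
by ring.
Qed.

End CaoSymplectomorphism.

(** * Solutions of the Cao equation *)

Section Profile.
Context {R : realType} (n : nat) (u : R -> R) (a : nat -> R).
Hypothesis n_gt0 : (0 < n)%N.
Hypothesis u_smooth : smooth u.
Hypothesis u_ode : forall t : R,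
  (u^`()%classic t) ^+ n.-1 * u^`(2)%classic t * expR (u^`()%classic t) = expR (n%:R * t).
Hypothesis u_exp : expansion_at_ninfty u a.
Hypothesis a1 : a 1%N = 1.
Implicit Types (t s : R) (z v : Cn R n).

Local Notation u' := (u^`()%classic).

Lemma is_derive_profile t : is_derive t 1 u (u' t).
Proof.
have [du _] := u_smooth 1.
by rewrite derive1E; apply/derivableP/derivable1_diffP.
Qed.

Lemma is_derive_profile1 t : is_derive t 1 u' (u^`(2)%classic t).
Proof.
have [_ /(_ 1) Cu'] := u_smooth 2.
have {}Cu' : Ck 1 u'.
  by rewrite (_ : u' = 'D_1 u)//; apply/funext => s; rewrite derive1E.
have [du' _] := Cu'.
by rewrite derive1nS derive1n1 derive1E; apply/derivableP/derivable1_diffP.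
Qed.

Lemma cvg_expR_ninfty : expR t @[t --> -oo_R] --> (0 : R).
Proof. by apply/cvgNy_compNP; exact: cvgr_expR. Qed.

Lemma profile1_expansion :
  exists C, \forall t \near -oo_R, `|u' t - expR t| <= C * expR t ^+ 2.
Proof.
(* Two terms, differentiated once: a_0 disappears and a_1 = 1 leaves exp t. *)
have [C HC] := u_exp 2 1; exists C; near=> t.
have : `|derive1n 1 (fun s : R => u s - \sum_(j < 2) a j * expR (j%:R * s)) t|
    <= C * expR (2 * t) by near: t.
rewrite expRM_natl derive1n1.
suff -> : (fun s : R => u s - \sum_(j < 2) a j * expR (j%:R * s))^`()%classic t =
  u' t - expR t by [].
rewrite (_ : (fun _ => _) = u - (cst (a 0%N) + expR)); last first.
  apply/funext => s; rewrite !fctE !big_ord_recl big_ord0 /= a1 mul0r expR0 mulr1 /bump/=.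
  by rewrite addn0 !mul1r addr0.
have du := is_derive_profile t.
have dae := is_deriveD (is_derive_cst (a 0%N) t (1 : R)) (is_derive_expR t).
rewrite derive1E; have [_ ->] := is_deriveB du dae.
by rewrite add0r.
Unshelve. all: by end_near. Qed.

Lemma cvg_profile1 : u' t @[t --> -oo_R] --> (0 : R).
Proof.
have [C HC] := profile1_expansion.
have e0 := cvg_expR_ninfty.
have e2 : C * (expR t * expR t) @[t --> -oo_R] --> (0 : R).
  rewrite -[X in _ --> X](mulr0 C) -[X in _ --> C * X](mulr0 (0 : R)).
  by apply: cvgMl_tmp; exact: cvgM.
apply: (@squeeze_cvgr _ _ _ R (fun t => expR t - C * (expR t * expR t))
  (fun t => expR t + C * (expR t * expR t))).
- near=> t; have : `|u' t - expR t| <= C * expR t ^+ 2 by near: t.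
  by rewrite ler_norml expr2; lra.
- by rewrite -[X in _ --> X](subr0 (0 : R)); exact: cvgB.
- by rewrite -[X in _ --> X](addr0 (0 : R)); exact: cvgD.
Unshelve. all: by end_near. Qed.

Lemma profile1_gt0_ninfty : \forall t \near -oo_R, 0 < u' t.
Proof.
have [C HC] := profile1_expansion.
(* Below this threshold C exp t < 1, so the error C exp(2t) is smaller than exp t. *)
have K0 : 0 < (`|C| + 1)^-1 by rewrite invr_gt0 ltr_wpDl.
near=> t; have : `|u' t - expR t| <= C * expR t ^+ 2 by near: t.
have : expR t < (`|C| + 1)^-1 by near: t; exact: cvgr_lt cvg_expR_ninfty _ K0.
rewrite -[ltRHS]mul1r ltr_pdivlMr ?ltr_wpDl// => CE.
rewrite ler_norml => /andP[H _].
have eC : C * expR t < 1.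
  apply: le_lt_trans CE; rewrite mulrC ler_pM2l ?expR_gt0//.
  by rewrite (le_trans (ler_norm _))// lerDl.
have := expR_gt0 t; move: (expR t) eC H => e eC H e0; nra.
Unshelve. all: by end_near. Qed.

(** The integrated Cao equation: by the ODE both sides have derivative n exp(n t), and both tend to
    0 at -oo. *)
Lemma radial_profile1_exp t : radial n (u' t) ^+ n = expR t ^+ n.
Proof.
pose P x : R := x ^+ n * kummer n x.
pose F s := n%:R * P (u' s) - expR (n%:R * s).
have F0 s : is_derive s 1 F 0.
  have d1 := is_derive_profile1 s.
  have dP := @is_derive1_comp R P u' s _ _ (is_derive_expn_kummer (u' s) n_gt0) d1.
  have dn : is_derive s 1 (n%:R \*: id) (n%:R *: 1 : R) by apply: is_deriveZ.
  have dE := @is_derive1_comp R expR (n%:R \*: id) s _ _ (is_derive_expR _) dn.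
  have dF := is_deriveB (is_deriveZ n%:R dP) dE.
  have {dF}dF : is_derive s 1 F _ := dF.
  apply: (is_derive_eq dF).
  rewrite /GRing.scale/= mulr1 mulrAC u_ode.
  by rewrite mulrC subrr.
have Fc : F t = 0.
  have cF : F s @[s --> -oo_R] --> (0 : R).
    have cP : {for (0 : R), continuous P}.
      have := is_derive_expn_kummer (0 : R) n_gt0.
      by move=> [? _]; apply/differentiable_continuous/derivable1_diffP.
    have P0 : P 0 = 0 by rewrite /P expr0n gtn_eqF// mul0r.
    have cPu : P (u' s) @[s --> -oo_R] --> (0 : R).
      by rewrite -[X in _ --> X]P0; apply: continuous_cvg => //; exact: cvg_profile1.
    have cE : expR s ^+ n @[s --> -oo_R] --> (0 : R).
      have -> : (0 : R) = 0 ^+ n by rewrite expr0n gtn_eqF.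
      exact: (cvg_comp _ _ cvg_expR_ninfty (@exprn_continuous R n 0)).
    rewrite (_ : F = fun s => n%:R * P (u' s) - expR s ^+ n); last first.
      by apply/funext => s; rewrite -expRM_natl.
    have -> : (0 : R) = n%:R * 0 - 0 by rewrite mulr0 subr0.
    by apply: cvgB => //; exact: cvgMl_tmp.
  (* [F] is constant, so its value at t is its limit at -oo. *)
  rewrite -(cvg_lim (@norm_hausdorff _ _) cF); apply/esym.
  apply: (lim_near_cst (@norm_hausdorff _ _)); near=> s.
  exact: (is_derive_0_is_cst s t F0).
by rewrite radial_exp// -expRM_natl; apply/eqP; rewrite -subr_eq0; apply/eqP.
Unshelve. all: by end_near. Qed.

(** By the integrated equation u' never vanishes, and it is positive near -oo. The sign is what lets
    [profile1E] extract an n-th root when n is even. *)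
Lemma profile1_gt0 t : 0 < u' t.
Proof.
have nz s : u' s != 0.
  apply/eqP => E; have := radial_profile1_exp s.
  rewrite E radial0 expr0n gtn_eqF// => /esym/eqP; rewrite expf_eq0 n_gt0/= => /eqP E'.
  by have := expR_gt0 s; rewrite E' ltxx.
rewrite ltNge; apply/negP => ut.
have [s [st us]] : exists s, s <= t /\ 0 < u' s.
  near -oo_R => s; exists s; split; last by near: s; exact: profile1_gt0_ninfty.
  by near: s; exact/nbhs_ninfty_le/num_real.
have [||c _] := @IVT R u' s t 0 st.
- apply: continuous_subspaceT => x; apply/differentiable_continuous/derivable1_diffP.
  by case: (is_derive_profile1 x).
- by rewrite ge_min ut orbT le_max (ltW us).
by apply/eqP.
Unshelve. all: by end_near. Qed.

Lemma profile1E t : u' t = moment n (expR t).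
Proof.
have := radial_profile1_exp t; move/eqP; rewrite eqrXn2// ?expR_ge0//.
  by move=> /eqP <-; rewrite radialK.
by rewrite -(radial0 n) ltW// radial_lt// profile1_gt0.
Qed.

(** In the variable s = exp t this says Phi - a_0 = O(||z||^2) at the origin. *)
Lemma profile_expansion : exists C M, 0 < M /\
  forall s, 0 < s -> s < M -> `|u (ln s) - a 0%N| <= C * s.
Proof.
have [C] := u_exp 1 0; rewrite derive1n0 => -[M [_ HM]].
exists C, (expR M); split=> [|s s0 sM]; first exact: expR_gt0.
have /= := HM (ln s); rewrite big_ord1 mul0r expR0 mulr1 mul1r lnK// => -> //.
by rewrite -ltr_expR lnK.
Qed.

Lemma metric_factorE z : z != 0 -> metric_factor z = moment_of z / normsq z.
Proof.
rewrite -normsq_eq0 => z0; apply: (mulIf z0); rewrite divfK//.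
rewrite -(radial_moment_of n_gt0) /radial /metric_factor /conformal.
by rewrite mulNr [_^-1 * _]mulrC mulrCA [expR (- _) * _]mulrC expRxMexpNx_1 mulr1.
Qed.

Lemma derive_potential z v :
  'D_v (potential u (a 0%N)) z = 2 * metric_factor z * inner z v.
Proof.
have [->|z0] := eqVneq z 0; last first.
  have nz0 : 0 < normsq z by rewrite lt_neqAle normsq_ge0 eq_sym normsq_eq0 z0.
  have [dl Dl] := chain_rule_real (is_derive1_ln nz0) (differentiable_normsq z) (derive_normsq v z).
  have [_ Du] := @chain_rule_real _ _ u (@ln R \o @normsq R n) z v _ _
    (is_derive_profile (ln (normsq z))) dl Dl.
  (* Near a nonzero point the case distinction in [potential] disappears. *)
  rewrite (@near_eq_derive _ _ _ _ (u \o (@ln R \o @normsq R n))).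
    rewrite Du profile1E lnK// metric_factorE// -/(moment_of z).
    by move: (normsq z)^-1 (moment_of z) (inner z v) => p q r; ring.
  near=> y; rewrite /potential ifF//; apply/negbTE; rewrite -normsq_eq0.
  near: y; apply: (@cvgr_neq0 _ _ _ _ _ _ (normsq z)); last by rewrite gt_eqF.
  exact/differentiable_continuous/differentiable_normsq.
(* At the origin the expected derivative is 0, and the difference quotient along v is O(h). *)
rewrite (_ : inner 0 v = 0) ?mulr0; last first.
  by rewrite /inner big1// => j _; rewrite /dx /dy !mxE !mul0r addr0.
have [->|v0] := eqVneq v 0; first by rewrite derive0.
have N0 : 0 < normsq v by rewrite lt_neqAle normsq_ge0 eq_sym normsq_eq0 v0.
have [C [M [M0 HC]]] := profile_expansion.
apply: cvg_lim => //; apply/cvgrPdist_lt => e e0; near=> h.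
have h0 : h != 0 by near: h; exact: nbhs_dnbhs_neq.
have h1 : `|h| < 1 by near: h; exact: dnbhs0_lt.
(* Together with |h| < 1 this puts ||h v||^2 below M. The next bound makes the quotient smaller than
   e; the added 1 keeps its divisor positive. *)
have hM : `|h| < M / normsq v by near: h; apply: dnbhs0_lt; rewrite divr_gt0.
have he : `|h| < e / ((`|C| + 1) * normsq v).
  by near: h; apply: dnbhs0_lt; rewrite divr_gt0// mulr_gt0// ltr_wpDl.
rewrite sub0r normrN normrZ normfV /= addr0 /potential eqxx scaler_eq0 (negbTE h0) (negbTE v0)/=.
rewrite mulrC ltr_pdivrMr ?normr_gt0// normsqZ -real_normK ?num_real//.
have hh : 0 < `|h| by rewrite normr_gt0.
move: h1 hM he; rewrite ltr_pdivlMr// ltr_pdivlMr ?mulr_gt0 ?ltr_wpDl//.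
move: (`|h|) hh => k k0 k1 kM ke.
apply: (le_lt_trans (HC _ _ _)).
- by rewrite mulr_gt0// exprn_gt0.
- by apply: le_lt_trans kM; rewrite ler_pM2r// expr2 ler_piMl ?ltW.
- apply: (@le_lt_trans _ _ ((`|C| + 1) * (k ^+ 2 * normsq v))).
    by apply: ler_wpM2r; [rewrite mulr_ge0 ?sqr_ge0 ?ltW|rewrite (le_trans (ler_norm _))// lerDl].
  by rewrite expr2 [ltRHS]mulrC; move: ke; rewrite -(ltr_pM2l k0); congr (is_true (_ < _)); ring.
Unshelve. all: by end_near. Qed.

End Profile.

(** * The form (i/2) ddbar of a radial potential *)

Section ComplexSums.
Context {R : realType} (n : nat).
Implicit Types (z : Cn R n) (j k : 'I_n).

(** The complex Hessian of a radial function is a multiple of the identity plus a rank one matrix;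
    this contracts such a matrix with wedge products. *)
Lemma sum_kronecker_rank1 (K : comPzRingType) (h e : K) (p q a b c d : 'I_n -> K) :
  \sum_j \sum_k (h * (j == k)%:R + e * (p j * q k)) * (a j * b k - c j * d k) =
  h * (\sum_j (a j * b j - c j * d j)) +
  e * ((\sum_j p j * a j) * (\sum_k q k * b k) - (\sum_j p j * c j) * (\sum_k q k * d k)).
Proof.
rewrite !big_distrlr /= -sumrB !mulr_sumr -big_split; apply: eq_bigr => j _ /=.
rewrite -sumrB mulr_sumr (bigD1 j)//= [in RHS](bigD1 j)//= addrA; congr (_ + _).
  by rewrite eqxx mulr1; ring.
apply: eq_bigr => k kj; rewrite [j == k]eq_sym (negbTE kj)/= mulr0 add0r; ring.
Qed.

Lemma complex_ext (x y : R[i]) :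
  complex.Re x = complex.Re y -> complex.Im x = complex.Im y -> x = y.
Proof. by case: x y => [x x'] [y y'] /= -> ->. Qed.

Lemma sum_complex (I : Type) (r : seq I) (F G : I -> R) :
  \sum_(i <- r) (F i +i* G i) = (\sum_(i <- r) F i) +i* (\sum_(i <- r) G i).
Proof.
elim: r => [|i r IHr]; first by rewrite !big_nil.
by rewrite !big_cons IHr.
Qed.

(** Used to cancel the division by 2 in the Wirtinger operators, so that real and imaginary parts
    can be compared directly. *)
Lemma half_complex (x y : R) : ((2 * x) +i* (2 * y)) / 2 = x +i* y :> R[i].
Proof.
have -> : (2 * x) +i* (2 * y) = (x +i* y) * 2 :> R[i].
  by rewrite mulr_natr mulr2n; apply/eqP; rewrite eq_complex /=; apply/andP; split; apply/eqP; ring.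
by rewrite mulfK// pnatr_eq0.
Qed.

Lemma innerx z k : inner z (delta_mx 0 (lshift n k)) = dx k z.
Proof.
rewrite /inner (bigD1 k)//= big1 => [|j jk]; rewrite /dx /dy !mxE/= ?eqxx.
  by rewrite eq_rlshift mulr1 mulr0 !addr0.
by rewrite eq_lshift (negbTE jk) eq_rlshift !mulr0 addr0.
Qed.

Lemma innery z k : inner z (delta_mx 0 (rshift n k)) = dy k z.
Proof.
rewrite /inner (bigD1 k)//= big1 => [|j jk]; rewrite /dx /dy !mxE/= ?eqxx.
  by rewrite eq_lrshift mulr1 mulr0 add0r addr0.
by rewrite eq_rshift (negbTE jk) eq_lrshift !mulr0 addr0.
Qed.

End ComplexSums.

Section RadialForm.
Context {R : realType} (n : nat) (phi H E : Cn R n -> R).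
Hypothesis derive_phi : forall z v, 'D_v phi z = 2 * H z * inner z v.
Hypothesis differentiable_H : forall z, differentiable H z.
Hypothesis derive_H : forall z v, 'D_v H z = 2 * E z * inner z v.
Implicit Types (z v w : Cn R n) (j k : 'I_n).

Lemma partial_zbar_radial k z :
  partial_zbar k (fun p => (phi p)%:C) z = (H z)%:C * dz k z.
Proof.
rewrite /partial_zbar /partial_x /partial_y /Dcomplex /= !derive_cst !derive_phi innerx innery.
rewrite -[RHS]half_complex; congr (_ / _).
by apply: complex_ext => /=; ring.
Qed.

Lemma Dcomplex_mul_dz v k z :
  Dcomplex v (fun p => (H p)%:C * dz k p) z =
  (H z * dx k v + 2 * E z * inner z v * dx k z) +i* (H z * dy k v + 2 * E z * inner z v * dy k z).
Proof.
have dH : is_derive z v H (2 * E z * inner z v).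
  by split; [exact/diff_derivable/differentiable_H|exact: derive_H].
have dc i : 'D_v (fun p : Cn R n => H p * p 0 i) z = H z * v 0 i + 2 * E z * inner z v * z 0 i.
  have dy : is_derive z v (fun p : Cn R n => p 0 i) (v 0 i).
    by split; [exact/diff_derivable/differentiable_coord|exact: derive_coord].
  by have [_ ->] := is_deriveM dH dy; rewrite /GRing.scale/= [z 0 i * _]mulrC.
rewrite /Dcomplex; congr (_ +i* _).
  rewrite -[RHS]dc; congr ('D_v _ z); apply/funext => p.
  by rewrite /= mul0r subr0.
rewrite -[RHS]dc; congr ('D_v _ z); apply/funext => p.
by rewrite /= mul0r addr0.
Qed.

(** With H = f' and E = f'', the Kronecker term comes from differentiating z_k and the rank one term
    from differentiating f'(s). *)
Lemma partial_z_zbar_radial j k z :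
  partial_z j (partial_zbar k (fun p => (phi p)%:C)) z =
  (H z)%:C * (j == k)%:R + (E z)%:C * (dzbar j z * dz k z).
Proof.
rewrite (_ : partial_zbar k _ = fun p => (H p)%:C * dz k p); last first.
  by apply/funext => p; exact: partial_zbar_radial.
rewrite /partial_z /partial_x /partial_y !Dcomplex_mul_dz innerx innery.
have -> : dx k (delta_mx 0 (lshift n j)) = (j == k)%:R :> R.
  by rewrite /dx mxE eqxx eq_lshift eq_sym.
have -> : dy k (delta_mx 0 (lshift n j)) = 0 :> R by rewrite /dy mxE eqxx eq_rlshift.
have -> : dx k (delta_mx 0 (rshift n j)) = 0 :> R by rewrite /dx mxE eqxx eq_lrshift.
have -> : dy k (delta_mx 0 (rshift n j)) = (j == k)%:R :> R.
  by rewrite /dy mxE eqxx eq_rshift eq_sym.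
have -> : (j == k)%:R = (j == k)%:R +i* 0 :> R[i] by case: (j == k).
move: ((j == k)%:R : R) => d.
rewrite -[RHS]half_complex; congr (_ / _).
by apply: complex_ext => /=; ring.
Qed.

(** The sums are Hermitian products <z, v> + i omega0(z, v) and their conjugates. Both
    antisymmetrised parts are purely imaginary with a factor -2i, which i/2 turns into 1. *)
Lemma omega_radial z v w :
  'i%C / 2 * ddbar (fun p => (phi p)%:C) z v w =
  (H z * omega0 z v w + E z * (inner z v * omega0 z z w - inner z w * omega0 z z v))%:C.
Proof.
rewrite /ddbar; under eq_bigr do under eq_bigr do rewrite partial_z_zbar_radial /wedge.
rewrite (sum_kronecker_rank1 _ _ (fun j => dzbar j z) (fun k => dz k z) (fun j => dz j v)
  (fun k => dzbar k w) (fun j => dz j w) (fun k => dzbar k v)).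
have A x : \sum_j dzbar j z * dz j x = inner z x +i* omega0 z z x.
  rewrite -sum_complex; apply: eq_bigr => j _; rewrite /wedge.
  by apply: complex_ext => /=; ring.
have B x : \sum_j dz j z * dzbar j x = inner z x -i* omega0 z z x.
  rewrite /omega0 -sumrN -sum_complex; apply: eq_bigr => j _; rewrite /wedge.
  by apply: complex_ext => /=; ring.
have W : \sum_j (dz j v * dzbar j w - dz j w * dzbar j v) = 0 +i* (- 2 * omega0 z v w).
  rewrite /omega0 mulr_sumr [X in X +i* _](_ : 0 = \sum_(j < n) 0); last by rewrite big1.
  rewrite -sum_complex.
  apply: eq_bigr => j _; rewrite /wedge.
  by apply: complex_ext => /=; ring.
rewrite !A !B W.
move: (H z) (E z) (inner z v) (inner z w) (omega0 z v w) (omega0 z z v) (omega0 z z w).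
move=> h e s s' o t t'.
rewrite mulrAC -[RHS]half_complex; congr (_ / _).
by apply: complex_ext => /=; ring.
Qed.

End RadialForm.

Theorem theorem1 (R : realType) (n : nat) (u : R -> R) (a : nat -> R)
  (n_ge1 : (1 <= n)%N)
  (u_smooth : smooth u)
  (u_ode : forall t : R,
     (u^`()%classic t) ^+ n.-1 * u^`(2)%classic t * expR (u^`()%classic t) = expR (n%:R * t))
  (u_exp : expansion_at_ninfty u a)
  (a1 : a 1%N = 1) :
  exists Psi : Cn R n -> R2n R n,
    diffeomorphism Psi /\
    forall z v w : Cn R n,
      (pullback Psi omega0 z v w)%:C = omegaRS u (a 0%N) z v w.
Proof.
exists (cao_map (n := n)); split; first exact: diffeomorphism_cao_map.
(* Both forms have the same expression, with H = [metric_factor] and E = [metric_slope]. *)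
move=> z v w; rewrite pullback_cao_map//; apply/esym/omega_radial.
- by move=> p x; exact: derive_potential.
- exact: differentiable_conformal.
- by move=> p x; rewrite derive_metric_factor.
Qed.
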